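(* Let $2\le M\le N$ be integers and let $\mathbf{T}\in\mathbb{C}^{M\times N}$ be full spark, where $\mathbf{T}=\mathbf{A}$ in the analog model and $\mathbf{T}=\mathbf{G}=\frac1N\mathbf{A}\mathbf{F}^H$ in the digital model. Let $\mathbf{\Phi}=\bar{\mathbf{T}}\odot\mathbf{T}\in\mathbb{C}^{M^2\times N}$. Then $\text{spark}(\mathbf{\Phi})\ge 2M$. Consequently, if $\mathbf{r}\in\mathbb{C}^N$ is $K_f$-sparse with $K_f<M$ and $\mathbf{r_z}=\mathbf{\Phi}\mathbf{r}$, then $\mathbf{r}$ is the unique sparsest solution $\mathbf{u}\in\mathbb{C}^N$ of the linear system $\mathbf{r_z}=\mathbf{\Phi}\mathbf{u}$. (This applies with $\mathbf{r}=\mathbf{r_x}(f)$, $\mathbf{r_z}=\mathbf{r_z}(f)$ for each $f$ in the analog model and with $\mathbf{r}=\mathbf{r_c}$ in the digital model.)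
   Context: An $M\times N$ matrix with $M\le N$ is full spark if every $M$ of its columns are linearly independent. $\text{spark}(\mathbf{\Phi})$ is the smallest number of columns of $\mathbf{\Phi}$ that are linearly dependent, with the convention that it equals $+\infty$ if all columns of $\mathbf{\Phi}$ are linearly independent. A vector is $K_f$-sparse if it has at most $K_f$ nonzero entries; a sparsest solution is one with the minimal number of nonzero entries. $\bar{\mathbf{T}}$ is the entrywise complex conjugate of $\mathbf{T}$, $\otimes$ the Kronecker product, and $\bar{\mathbf{T}}\odot\mathbf{T}$ (Khatri–Rao product) is the $M^2\times N$ matrix whose $j$th column is $\bar{\mathbf{t}}_j\otimes\mathbf{t}_j$, with $\mathbf{t}_j$ the $j$th column of $\mathbf{T}$. In the analog model, $\mathbf{z}(f)=\mathbf{A}\mathbf{x}(f)$ for each frequency $f$ in an interval, $\mathbf{A}\in\mathbb{C}^{M\times N}$ is the sampling matrix, $\mathbf{R_x}(f)=\mathbb{E}[\mathbf{x}(f)\mathbf{x}^H(f)]$ is diagonal with diagonal vector $\mathbf{r_x}(f)$, and $\mathbf{r_z}(f)=\text{vec}(\mathbb{E}[\mathbf{z}(f)\mathbf{z}^H(f)])=\mathbf{\Phi}\mathbf{r_x}(f)$. In the digital model, $\mathbf{z}=\mathbf{G}\mathbf{c}$ with $\mathbf{G}=\frac1N\mathbf{A}\mathbf{F}^H$, $\mathbf{F}$ the $N\times N$ DFT matrix, $\mathbf{A}\in\mathbb{C}^{M\times N}$, $\mathbf{R_c}=\mathbb{E}[\mathbf{c}\mathbf{c}^H]$ is diagonal with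 diagonal vector $\mathbf{r_c}$, and $\mathbf{r_z}=\text{vec}(\mathbb{E}[\mathbf{z}\mathbf{z}^H])=\mathbf{\Phi}\mathbf{r_c}$. *)

(* Defs.v *)
From HB Require Import structures.
From mathcomp Require Import all_boot all_order all_algebra.
From mathcomp Require Import complex mxtens.
From mathcomp Require Import all_classical all_reals all_analysis.

Set Implicit Arguments.
Unset Strict Implicit.
Unset Printing Implicit Defensive.

Import Order.TTheory GRing.Theory Num.Theory.

Local Open Scope ring_scope.
Local Open Scope complex_scope.

(* Columns are indexed by j, so a repeated column counts as dependent. *)
Definition cols_free (R : realType) m n (A : 'M[R[i]]_(m, n))
    (S : {set 'I_n}) : bool :=
  free [seq col j A | j in S].

Definition full_spark (R : realType) m n (A : 'M[R[i]]_(m, n)) : Prop :=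
  forall S : {set 'I_n}, #|S| = m -> cols_free A S.

(* The default value of the minimum gives +oo when all columns together are
   linearly independent. *)
Definition spark (R : realType) m n (A : 'M[R[i]]_(m, n)) : \bar R :=
  \big[Order.min/+oo%E]_(S : {set 'I_n} | ~~ cols_free A S) (#|S|%:R : R)%:E.

Definition conjc_mx (R : realType) m n (A : 'M[R[i]]_(m, n)) : 'M[R[i]]_(m, n) :=
  map_mx (@conjc R) A.

Definition hermmx (R : realType) m n (A : 'M[R[i]]_(m, n)) : 'M[R[i]]_(n, m) :=
  (conjc_mx A)^T.

Definition khatri_rao (R : realType) m p n
    (A : 'M[R[i]]_(m, n)) (B : 'M[R[i]]_(p, n)) : 'M[R[i]]_(m * p, n) :=
  \matrix_(i, j) (col j A *t col j B) i ord0.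

(* Column stacking: entry A i j sits at position j * m + i. *)
Definition vec (R : realType) m n (A : 'M[R[i]]_(m, n)) : 'cV[R[i]]_(n * m) :=
  \col_k A (mxtens_unindex k).2 (mxtens_unindex k).1.

Definition diagv (R : realType) n (A : 'M[R[i]]_n) : 'cV[R[i]]_n :=
  \col_i A i i.

(* Entry (j, k) is exp(- 2 pi i j k / n). *)
Definition dftmx (R : realType) n : 'M[R[i]]_n :=
  \matrix_(j, k) let t := 2 * pi * (j * k)%:R / n%:R in cos t -i* sin t.

Definition nnz (R : realType) n (u : 'cV[R[i]]_n) : nat :=
  #|[set j | u j ord0 != 0]|.

Definition sparse (R : realType) n (K : nat) (u : 'cV[R[i]]_n) : Prop :=
  (nnz u <= K)%N.

Definition sparsest_solution (R : realType) m n (A : 'M[R[i]]_(m, n))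
    (b : 'cV[R[i]]_m) (u : 'cV[R[i]]_n) : Prop :=
  b = A *m u /\ forall v : 'cV[R[i]]_n, b = A *m v -> (nnz u <= nnz v)%N.

Section RandomVectors.
Context {R : realType} {d : measure_display} {Omega : measurableType d}.
Variable P : probability Omega R.

(* Square integrability makes every entry of E[x x^H] a convergent integral, so
   that [fine] below does not discard an infinite value. *)
Definition square_integrable n (x : Omega -> 'cV[R[i]]_n) : Prop :=
  forall j, (fun w => complex.Re (x w j ord0)) \in Lfun P 2%:E
         /\ (fun w => complex.Im (x w j ord0)) \in Lfun P 2%:E.

Definition cexpectation (X : Omega -> R[i]) : R[i] :=
  fine ('E_P[fun w => complex.Re (X w)])%E +i* fine ('E_P[fun w => complex.Im (X w)])%E.

Definition mxexpectation m n (X : Omega -> 'M[R[i]]_(m, n)) : 'M[R[i]]_(m, n) :=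
  \matrix_(j, k) cexpectation (fun w => X w j k).

Definition corrmx n (x : Omega -> 'cV[R[i]]_n) : 'M[R[i]]_n :=
  mxexpectation (fun w => x w *m hermmx (x w)).

End RandomVectors.

(* Main.v *)
Require Import Defs.
From HB Require Import structures.
From mathcomp Require Import all_boot all_order all_algebra.
From mathcomp Require Import complex mxtens.
From mathcomp Require Import all_classical all_reals all_analysis.
From mathcomp Require Import zify ring.

Set Implicit Arguments.
Unset Strict Implicit.
Unset Printing Implicit Defensive.

Import Order.TTheory GRing.Theory Num.Theory.

Local Open Scope ring_scope.
Local Open Scope complex_scope.

(** A vector [u] in the kernel of the Khatri-Rao product satisfies sum_j u_j t_j t_j^H = 0, where
    t_j are the columns of [T]. If u_j0 is nonzero and the support has at most 2M - 1 elements, it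
    is covered by two sets of at most M indices that share only j0. Full spark gives, on each set, a
    linear functional equal to 1 at t_j0 and 0 at the other columns of that set. Applying one
    functional on the left and the conjugate of the other on the right kills every term except u_j0,
    a contradiction ([full_spark_dual], [khatri_rao_ker]). The spark bound follows at once. So does
    uniqueness: two solutions with fewer than M nonzero entries each differ by a kernel vector with
    fewer than 2M. Both signal models reduce to this system by linearity of expectation: E[z z^H] =
    T E[x x^H] T^H, and a diagonal middle factor turns its vectorization into the Khatri-Rao form
    ([corrmx_mulmx], [vec_mul_diag]). *)

Section Spark.
Context {R : realType}.
Implicit Types (m n M N : nat).

(** * Sparse kernel vectors of the Khatri-Rao product, spark and uniqueness *)

Lemma exists_card_between (I : finType) (A B : {set I}) k :
  A \subset B -> (#|A| <= k <= #|B|)%N ->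
  exists D : {set I}, [/\ A \subset D, D \subset B & #|D| = k].
Proof.
move=> AB /andP[]; elim: k => [|k IH] Ak kB.
  by exists A; split => //; apply/eqP; rewrite -leqn0.
move: Ak; rewrite leq_eqVlt => /orP[/eqP e|Ak]; first by exists A.
have [D [AD DB cD]] := IH Ak (ltnW kB).
have /properP[_ [x xB xD]] : D \proper B by rewrite properEcard DB cD.
exists (x |: D); split.
- exact: (fintype.subset_trans AD (finset.subsetU1 _ _)).
- by rewrite finset.subUset finset.sub1set xB.
- by rewrite cardsU1 xD cD.
Qed.

Lemma cols_free_of_ker m n (A : 'M[R[i]]_(m, n)) (S : {set 'I_n}) :
  (forall u : 'cV[R[i]]_n,
     (forall j, j \notin S -> u j ord0 = 0) -> A *m u = 0 -> u = 0) ->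
  cols_free A S.
Proof.
move=> ker0; apply/(@freeP _ _ _ (image_tuple (fun j => col j A) S)) => k k0 i.
(* The coefficients are indexed by positions in the enumeration of [S]; [u] is their extension by
   zero to all column indices. *)
pose u : 'cV[R[i]]_n := \col_j \sum_l (enum_val l == j)%:R * k l.
have uE l : u (enum_val l) ord0 = k l.
  rewrite mxE (bigD1 l) //= eqxx mul1r big1 ?addr0 // => l' /negPf ll'.
  by rewrite (inj_eq enum_val_inj) ll' mul0r.
have u0 j : j \notin S -> u j ord0 = 0.
  move=> jS; rewrite mxE big1 // => l _; case: eqP => [e|_]; last by rewrite mul0r.
  by move: jS; rewrite -e enum_valP.
suff /colP/(_ (enum_val i)) : u = 0 by rewrite uE mxE.
apply: ker0 => //; apply/colP => a; rewrite mxE (bigID (mem S)) /=.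
rewrite [X in _ + X]big1 ?addr0 => [|j jS]; last by rewrite u0 ?mulr0.
move/colP/(_ a): k0; rewrite summxE => k0.
rewrite [LHS]big_enum_val -[RHS]k0; apply: eq_bigr => l _.
by rewrite uE nth_image !mxE mulrC.
Qed.

(** Extend [B] to M indices. The corresponding columns are free by full spark, so the coordinate
    functional of column [j0] is available; [a] lists its values on the standard basis. *)
Lemma full_spark_dual M N (T : 'M[R[i]]_(M, N)) (B : {set 'I_N}) (j0 : 'I_N) :
  (M <= N)%N -> full_spark T -> (#|B| <= M)%N -> j0 \in B ->
  exists a : 'I_M -> R[i],
    forall j, j \in B -> \sum_i a i * T i j = (j == j0)%:R.
Proof.
move=> MN spT cB j0B.
have [D [BD cD]] : exists D : {set 'I_N}, B \subset D /\ #|D| = M.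
  have [||D [BD _ cD]] := @exists_card_between _ B [set: 'I_N] M.
  - exact: finset.subsetT.
  - by rewrite cB cardsT card_ord.
  - by exists D.
have /= := spT _ cD; rewrite /cols_free => freeD.
have j0D := fintype.subsetP BD _ j0B.
pose X := image_tuple (fun j => col j T) D.
pose f := coord X (enum_rank_in j0D j0).
exists (fun i => f (delta_mx i ord0)) => j jB.
have jD := fintype.subsetP BD _ jB.
have -> : \sum_i f (delta_mx i ord0) * T i j = f (col j T).
  rewrite [col j T]matrix_sum_delta /f linear_sum; apply: eq_bigr => i _.
  by rewrite big_ord1 linearZ /= mxE mulrC.
have -> : col j T = X`_(enum_rank_in j0D j).
  by rewrite nth_image enum_rankK_in.
by rewrite /f coord_free // (can_in_eq (enum_rankK_in j0D)).
Qed.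

(* The system says [\sum_j u_j t_j t_j^H = 0].  Cover the support of [u] by two
   sets of at most [M] indices meeting only in [j0], and sandwich this sum
   between functionals that are dual to [j0] on each of them. *)
Lemma khatri_rao_ker M N (T : 'M[R[i]]_(M, N)) (u : 'cV[R[i]]_N) :
  (0 < M <= N)%N -> full_spark T -> (nnz u < 2 * M)%N ->
  khatri_rao (conjc_mx T) T *m u = 0 -> u = 0.
Proof.
move=> /andP[M0 MN] spT cu ku; apply/colP => j0; rewrite [RHS]mxE.
apply/eqP/negPn/negP => uj0.
move: cu; rewrite /nnz; set S := finset _ => cu.
have j0S : j0 \in S by rewrite inE.
have S0 : (0 < #|S|)%N by apply/card_gt0P; exists j0.
(* Taking [B] as large as M and the support allow leaves at most M - 1 indices of [S] outside it, so
   adding [j0] to them keeps [C] within M. *)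
have [||B [j0B BS cB]] := @exists_card_between _ [set j0]%SET S (minn M #|S|).
- by rewrite finset.sub1set.
- by rewrite cards1 leq_min M0 S0 geq_minr.
have {}j0B : j0 \in B by rewrite -finset.sub1set.
pose C := j0 |: (S :\: B).
have cC : (#|C| <= M)%N.
  rewrite /C cardsU1 !inE j0B /= add1n cardsD (finset.setIidPr BS) cB /minn.
  by case: (ltnP M #|S|); lia.
have [|a aE] := full_spark_dual MN spT _ j0B; first by rewrite cB geq_minl.
have j0C : j0 \in C by rewrite !inE eqxx.
have [b bE] := full_spark_dual MN spT cC j0C.
have {}bE j : j \in C -> (\sum_k b k * T k j)^*%C = (j == j0)%:R.
  by move=> /bE ->; case: (j == j0); [exact: conjc1|exact: conjc0].
(* The sandwich b^H-type contraction of the zero vector: [k] indexes the conjugated factor and [i]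
   the plain one, so each column [j] contributes a product of two separate sums. *)
have : \sum_k \sum_i (b k)^*%C * a i *
    (khatri_rao (conjc_mx T) T *m u) (mxtens_index (k, i)) ord0 = 0.
  by rewrite ku big1 // => k _; rewrite big1 // => i _; rewrite mxE mulr0.
under eq_bigr => k _ do under eq_bigr => i _ do rewrite mxE mulr_sumr.
under eq_bigr => k _ do rewrite exchange_big /=.
rewrite exchange_big /=.
under eq_bigr => j _.
  have -> : \sum_k \sum_i (b k)^*%C * a i *
      (khatri_rao (conjc_mx T) T (mxtens_index (k, i)) j * u j ord0) =
      (\sum_k b k * T k j)^*%C * (\sum_i a i * T i j) * u j ord0.
    rewrite rmorph_sum /= !mulr_suml; apply: eq_bigr => k _.
    rewrite mulr_sumr mulr_suml; apply: eq_bigr => i _.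
    by rewrite !mxE mxtens_indexK rmorphM /=; ring.
  over.
rewrite (bigD1 j0) //= aE // bE // eqxx !mul1r.
rewrite big1 ?addr0 => [/eqP|j jj0]; first exact/negP.
(* For [j] other than [j0], the term vanishes through [a] on [B], through [u] off [S], and through
   [b] on the rest, which lies in [C]. *)
have [jB|jB] := boolP (j \in B); first by rewrite aE // (negPf jj0) mulr0 mul0r.
have [jS|] := boolP (j \in S); last by rewrite inE negbK => /eqP ->; rewrite mulr0.
have jC : j \in C by rewrite /C finset.in_setU1 finset.in_setD jB jS orbT.
by rewrite (bE _ jC) (negPf jj0) !mul0r.
Qed.

Lemma spark_khatri_rao_ge M N (T : 'M[R[i]]_(M, N)) :
  (0 < M <= N)%N -> full_spark T ->
  (((2 * M)%:R : R)%:E <= spark (khatri_rao (conjc_mx T) T))%E.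
Proof.
move=> MN spT; apply/bigmin_geP; split => [|S]; first exact: leey.
apply: contraR; rewrite lee_fin ler_nat -ltnNge => cS.
apply: cols_free_of_ker => u uS; apply: khatri_rao_ker => //.
apply: leq_ltn_trans cS; apply/subset_leq_card/fintype.subsetP => j.
by rewrite inE; apply: contraR => /uS ->.
Qed.

Lemma nnzB n (u v : 'cV[R[i]]_n) : (nnz (u - v) <= nnz u + nnz v)%N.
Proof.
rewrite /nnz -cardsUI (leq_trans _ (leq_addr _ _)) //.
apply/subset_leq_card/fintype.subsetP => j; rewrite !inE !mxE.
by apply: contraR; rewrite negb_or !negbK => /andP[/eqP -> /eqP ->]; rewrite subr0.
Qed.

Lemma khatri_rao_unique_sparsest M N (T : 'M[R[i]]_(M, N)) Kf
    (r : 'cV[R[i]]_N) (rz : 'cV[R[i]]_(M * M)) :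
  (0 < M <= N)%N -> full_spark T -> (Kf < M)%N -> sparse Kf r ->
  rz = khatri_rao (conjc_mx T) T *m r ->
  unique (sparsest_solution (khatri_rao (conjc_mx T) T) rz) r.
Proof.
move=> MN spT KM rK rzE.
(* Comparing with any solution at most as sparse as [r] gives both minimality and uniqueness. *)
have uniq v : rz = khatri_rao (conjc_mx T) T *m v -> (nnz v <= nnz r)%N -> r = v.
  move=> vE vr; apply/eqP; rewrite -subr_eq0; apply/eqP.
  apply: (khatri_rao_ker MN spT); last by rewrite mulmxBr -rzE -vE subrr.
  by apply: leq_ltn_trans (nnzB _ _) _; move: rK; rewrite /sparse; lia.
split; last by move=> v [vE vmin]; apply: uniq => //; exact: vmin.
by split=> // v vE; have [/(uniq _ vE) ->|/ltnW] := leqP (nnz v) (nnz r).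
Qed.

End Spark.

(** * Linearity of complex expectation and correlation matrices of linear images *)

Lemma ReD (R : realType) (x y : R[i]) :
  complex.Re (x + y) = complex.Re x + complex.Re y.
Proof. by case: x; case: y. Qed.

Lemma ImD (R : realType) (x y : R[i]) :
  complex.Im (x + y) = complex.Im x + complex.Im y.
Proof. by case: x; case: y. Qed.

Lemma ReM (R : realType) (x y : R[i]) :
  complex.Re (x * y) = complex.Re x * complex.Re y - complex.Im x * complex.Im y.
Proof. by case: x; case: y. Qed.

Lemma ImM (R : realType) (x y : R[i]) :
  complex.Im (x * y) = complex.Re x * complex.Im y + complex.Im x * complex.Re y.
Proof. by case: x; case: y. Qed.

Section Correlation.
Context {R : realType} {d : measure_display} {Omega : measurableType d}.
Variable P : probability Omega R.

Definition cintegrable (X : Omega -> R[i]) : Prop :=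
  (fun w => complex.Re (X w)) \in Lfun P 1 /\
  (fun w => complex.Im (X w)) \in Lfun P 1.

Lemma cintegrable0 : cintegrable (fun=> 0).
Proof. by split; exact: (Lfun_cst P 0 1). Qed.

Lemma cexpectation0 : cexpectation P (fun=> 0) = 0.
Proof. by rewrite /cexpectation /= (expectation_cst P 0). Qed.

Lemma cintegrableD X Y :
  cintegrable X -> cintegrable Y -> cintegrable (fun w => X w + Y w).
Proof.
move=> [X1 X2] [Y1 Y2]; split.
  by under eq_fun do rewrite ReD; exact: (rpredD X1 Y1).
by under eq_fun do rewrite ImD; exact: (rpredD X2 Y2).
Qed.

Lemma cexpectationD X Y : cintegrable X -> cintegrable Y ->
  cexpectation P (fun w => X w + Y w) = cexpectation P X + cexpectation P Y.
Proof.
move=> [X1 X2] [Y1 Y2]; rewrite /cexpectation.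
under eq_fun do rewrite ReD.
under [X in _ +i* fine (expectation _ X)]eq_fun do rewrite ImD.
by rewrite !expectationD // !fineD ?expectation_fin_num.
Qed.

Lemma cintegrableZ c X : cintegrable X -> cintegrable (fun w => c * X w).
Proof.
move=> [X1 X2]; split.
  under eq_fun do rewrite ReM.
  exact: (rpredB (rpredZ (complex.Re c) X1) (rpredZ (complex.Im c) X2)).
under eq_fun do rewrite ImM.
exact: (rpredD (rpredZ (complex.Re c) X2) (rpredZ (complex.Im c) X1)).
Qed.

Lemma cexpectationZ c X : cintegrable X ->
  cexpectation P (fun w => c * X w) = c * cexpectation P X.
Proof.
move=> [X1 X2]; rewrite /cexpectation.
(* The scalars move to the right, the form in which the scaling lemmas for expectations and [Lfun]
   apply. *)
under eq_fun do rewrite ReM (mulrC (complex.Re c)) (mulrC (complex.Im c)).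
under [X in _ +i* fine (expectation _ X)]eq_fun
  do rewrite ImM (mulrC (complex.Re c)) (mulrC (complex.Im c)).
rewrite (expectationB (Lfun_scale _ (lexx 1) X1) (Lfun_scale _ (lexx 1) X2)).
rewrite (expectationD (Lfun_scale _ (lexx 1) X2) (Lfun_scale _ (lexx 1) X1)).
rewrite !expectationZl // fineB ?fineD ?fin_numM ?expectation_fin_num //.
by rewrite !fineM ?expectation_fin_num //; case: c.
Qed.

Lemma cintegrable_sum (I : Type) (r : seq I) (F : I -> Omega -> R[i]) :
  (forall i, cintegrable (F i)) -> cintegrable (fun w => \sum_(i <- r) F i w).
Proof.
move=> intF; elim: r => [|i r IH].
  by under eq_fun do rewrite big_nil; exact: cintegrable0.
by under eq_fun do rewrite big_cons; exact: cintegrableD.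
Qed.

Lemma cexpectation_sum (I : Type) (r : seq I) (F : I -> Omega -> R[i]) :
  (forall i, cintegrable (F i)) ->
  cexpectation P (fun w => \sum_(i <- r) F i w) =
  \sum_(i <- r) cexpectation P (F i).
Proof.
move=> intF; elim: r => [|i r IH].
  by under eq_fun do rewrite big_nil; rewrite big_nil cexpectation0.
under eq_fun do rewrite big_cons.
by rewrite cexpectationD ?IH ?big_cons //; exact: cintegrable_sum.
Qed.

(** The real and imaginary parts are sums and differences of products of two square-integrable real
    functions, each integrable by the Cauchy-Schwarz inequality. *)
Lemma cintegrable_mul_conj n (x : Omega -> 'cV[R[i]]_n) (a b : 'I_n) :
  square_integrable P x ->
  cintegrable (fun w => x w a ord0 * (x w b ord0)^*).
Proof.
move=> sqx; have [a1 a2] := sqx a; have [b1 b2] := sqx b.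
have Reconj (y : R[i]) : complex.Re y^* = complex.Re y by case: y.
have Imconj (y : R[i]) : complex.Im y^* = - complex.Im y by case: y.
split.
  under eq_fun do rewrite ReM Reconj Imconj mulrN opprK.
  exact: (rpredD (Lfun2_mul_Lfun1 a1 b1) (Lfun2_mul_Lfun1 a2 b2)).
under eq_fun do rewrite ImM Reconj Imconj mulrN addrC.
exact: (rpredB (Lfun2_mul_Lfun1 a2 b1) (Lfun2_mul_Lfun1 a1 b2)).
Qed.

Lemma corrmx_mulmx m n (A : 'M[R[i]]_(m, n)) (x : Omega -> 'cV[R[i]]_n) :
  square_integrable P x ->
  corrmx P (fun w => A *m x w) = A *m corrmx P x *m hermmx A.
Proof.
move=> sqx; apply/matrixP => j k; rewrite !mxE.
rewrite (_ : (fun w => _) = fun w => \sum_b \sum_a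
    (A j a * (A k b)^*) * (x w a ord0 * (x w b ord0)^*)); last first.
  apply/funext => w; rewrite mxE big_ord1 !mxE rmorph_sum /= mulr_sumr.
  apply: eq_bigr => b _; rewrite mulr_suml; apply: eq_bigr => a _.
  by rewrite rmorphM /=; ring.
have intx a b := cintegrableZ (A j a * (A k b)^*) (cintegrable_mul_conj a b sqx).
rewrite cexpectation_sum => [|b]; last exact: cintegrable_sum.
apply: eq_bigr => b _; rewrite cexpectation_sum // !mxE mulr_suml.
apply: eq_bigr => a _; rewrite cexpectationZ; last exact: cintegrable_mul_conj.
rewrite !mxE mulrAC; congr (_ * cexpectation P _ * _).
by apply/funext => w; rewrite mxE big_ord1 !mxE.
Qed.

(** Column stacking puts the column index of T D T^H first, and that index comes from T^H; hence the
    conjugate is the left Khatri-Rao factor. *)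
Lemma vec_mul_diag M N (T : 'M[R[i]]_(M, N)) (D : 'M[R[i]]_N) :
  is_diag_mx D ->
  vec (T *m D *m hermmx T) = khatri_rao (conjc_mx T) T *m diagv D.
Proof.
move=> /is_diag_mxP D0; apply/colP => k; rewrite !mxE; apply: eq_bigr => b _.
rewrite !mxE (bigD1 b) //= big1 ?addr0 => [|a ab]; first ring.
by rewrite D0 ?mulr0.
Qed.

Lemma vec_corrmx_mulmx M N (T : 'M[R[i]]_(M, N)) (x : Omega -> 'cV[R[i]]_N)
    (z : Omega -> 'cV[R[i]]_M) :
  square_integrable P x -> is_diag_mx (corrmx P x) ->
  (forall w, z w = T *m x w) ->
  vec (corrmx P z) = khatri_rao (conjc_mx T) T *m diagv (corrmx P x).
Proof.
move=> sqx diagx /funext ->; rewrite corrmx_mulmx //; exact: vec_mul_diag.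
Qed.

End Correlation.

Theorem mainTheorem3 (R : realType) (M N : nat) (hM : (2 <= M)%N)
    (hMN : (M <= N)%N) :
  [/\ (* arbitrary full spark T *)
      forall T : 'M[R[i]]_(M, N), full_spark T ->
        let Phi := khatri_rao (conjc_mx T) T in
        (((2 * M)%:R : R)%:E <= spark Phi)%E
        /\ forall (Kf : nat) (r : 'cV[R[i]]_N) (rz : 'cV[R[i]]_(M * M)),
             (Kf < M)%N -> sparse Kf r -> rz = Phi *m r ->
             unique (sparsest_solution Phi rz) r,
      (* analog model, T = A *)
      forall (d : measure_display) (Omega : measurableType d)
             (P : probability Omega R) (I : interval R) (A : 'M[R[i]]_(M, N))
             (x : R -> Omega -> 'cV[R[i]]_N) (z : R -> Omega -> 'cV[R[i]]_M),
        full_spark A ->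
        (forall f, f \in I -> square_integrable P (x f)) ->
        (forall f, f \in I -> is_diag_mx (corrmx P (x f))) ->
        (forall f, f \in I -> forall w, z f w = A *m x f w) ->
        let Phi := khatri_rao (conjc_mx A) A in
        forall f, f \in I ->
        let rx := diagv (corrmx P (x f)) in
        let rz := vec (corrmx P (z f)) in
        forall Kf : nat, (Kf < M)%N -> sparse Kf rx ->
          unique (sparsest_solution Phi rz) rx
    & (* digital model, T = G = (1/N) A F^H *)
      forall (d : measure_display) (Omega : measurableType d)
             (P : probability Omega R) (A : 'M[R[i]]_(M, N))
             (c : Omega -> 'cV[R[i]]_N) (z : Omega -> 'cV[R[i]]_M),
        let G := (N%:R : R[i])^-1 *: (A *m hermmx (dftmx R N)) in
        full_spark G ->
        square_integrable P c ->
        is_diag_mx (corrmx P c) ->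
        (forall w, z w = G *m c w) ->
        let Phi := khatri_rao (conjc_mx G) G in
        let rc := diagv (corrmx P c) in
        let rz := vec (corrmx P z) in
        forall Kf : nat, (Kf < M)%N -> sparse Kf rc ->
          unique (sparsest_solution Phi rz) rc].
Proof.
have MN : (0 < M <= N)%N by rewrite hMN (ltnW hM).
split.
- move=> T spT Phi; split; first exact: spark_khatri_rao_ge.
  by move=> Kf r rz KM rK rzE; exact: (khatri_rao_unique_sparsest MN spT KM rK rzE).
- move=> d Omega P I A x z spA sqx diagx zE Phi f fI rx rz Kf KM rK.
  apply: (khatri_rao_unique_sparsest MN spA KM rK).
  exact: (vec_corrmx_mulmx (sqx f fI) (diagx f fI) (zE f fI)).
move=> d Omega P A c z G spG sqc diagc zE Phi rc rz Kf KM rK.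
apply: (khatri_rao_unique_sparsest MN spG KM rK).
exact: (vec_corrmx_mulmx sqc diagc zE).
Qed.
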